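(* Let $\mathcal H$ be a commutative non-degenerate combinatorial Hopf algebra, let $(S_v)_v$ be a substitution with coaction $\rho_S$, and let $(T_v)_v$ be the translation induced by $T_{v'}=S_v$ for $v'=\{v_1-e_1,\dots,v_n-e_n\}$, with coaction $\rho_T$. Define the linear map $\phi:S(\mathcal H_{in}\times\mathcal B_1)\to S(\mathcal H_{in}\times\mathcal B_1)$ by $$\phi((x,e_i))=\begin{cases}1+(e_i,e_i),& x=e_i,\\ (x,e_i),&\text{otherwise,}\end{cases}$$ for $x$ in a homogeneous basis of $\mathcal H_{in}$ containing the (classes of the) elements of $\mathcal B_1$, and $\phi(x\cdot y)=\phi(x)\cdot\phi(y)$. Then $$\rho_T=(\phi\otimes\mathrm{Id})\rho_S.$$
   Context: **Combinatorial Hopf algebras.** The ground field is $\mathbb K=\mathbb R$. A combinatorial Hopf algebra is a graded connected Hopf algebra $\mathcal H=\bigoplus_{n\ge0}\mathcal H_n$ (connected: the unit map is an isomorphism $\mathbb K\to\mathcal H_0$) with product $\odot$, coproduct $\Delta$, counit $\epsilon$, together with a basis $\mathcal B=\bigcup_n\mathcal B_n$ of homogeneous elements ($\mathcal B_n\subset\mathcal H_n$) such that $\dim\mathcal H_n\le bc^n$ for some positive constants $b,c$, and the structure constants of $\odot$ and $\Delta$ in the basis $\mathcal B$ are non-negative integers. It is non-degenerate if $\mathcal B\cap\mathrm{Prim}(\mathcal H)=\mathcal B_1$. Write $\mathcal B_1=\{e_1,\dots,e_n\}$ and $|x|$ for degree. **Duals.** $\mathcal H^*$ is the graded dual, with product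 $*$ dual to $\Delta$ and coproduct $\Delta_\odot$ dual to $\odot$; it is identified with $\mathcal H$ through the basis dual to $\mathcal B$ (so $e_i$ also denotes the dual basis element). $\overline{\mathcal H^*}=\prod_n\mathcal H_n^*$ is its completion, i.e. all linear forms on $\mathcal H$, with convolution product $*$ and the completed coproduct. $v\in\overline{\mathcal H^*}$ is primitive if it vanishes on $1$ and on $\ker\epsilon\odot\ker\epsilon$ (infinitesimal character). Characters are unital algebra morphisms $(\mathcal H,\odot)\to\mathbb K$. **The Hopf algebra $S$.** $\mathcal H_{in}=\ker\epsilon/(\ker\epsilon\odot\ker\epsilon)$ denotes the indecomposables; $\mathcal H_{in}\times\mathcal B_1$ is the vector space of pairs $(w,e_i)$, linear in the first component (so it is $\bigoplus_i\mathcal H_{in}$). $(S(\mathcal H_{in}\times\mathcal B_1),\cdot,\Delta_{\cdot})$ is the free unital commutative algebra on it, with the coproduct for which generators are primitive. For a tuple $v=\{v_1,\dots,v_n\}$ of primitive elements of $\overline{\mathcal H^*}$, $e^v=\exp^{\cdot}(\sum_i(v_i,e_i))$ is the character of $S(\mathcal H_{in}\times\mathcal B_1)$ with $\langle e^v,(w,e_i)\rangle=\langle v_i,w\rangle$. **Rough paths.** For $\gamma\in(0,1]$, a $\gamma$-regular $\mathcal H$-rough path is a family $(\mathbb X_{st})_{s,t\in\mathbb R}$ of linear forms on $\mathcal H$ with $\langle\mathbb X_{st},1\rangle=1$, $\langle\mathbb X_{st},x\odot y\rangle=\langle\mathbb X_{st},x\rangle\langle\mathbb X_{st},y\rangle$,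 $\mathbb X_{su}*\mathbb X_{ut}=\mathbb X_{st}$, and $\sup_{s\ne t}|\langle\mathbb X_{st},x\rangle|/|t-s|^{\gamma|x|}<\infty$ for every $x\in\mathcal B$. **Translation.** A family of algebra morphisms $T_v:\overline{\mathcal H^*}\to\overline{\mathcal H^*}$, indexed by tuples $v=\{v_1,\dots,v_n\}$ of primitive elements of $\overline{\mathcal H^*}$, is a translation if: 1. $T_v(e_i)=e_i+v_i$ for all $e_i\in\mathcal B_1$; 2. $T_v\circ T_u=T_{v+T_v(u)}$, where $T_v(u)=\{T_v(u_1),\dots,T_v(u_n)\}$; 3. for each ($\gamma$-regular) $\mathcal H$-rough path $\mathbb X$, $T_v(\mathbb X)_{st}:=T_v(\mathbb X_{st})$ is an $\mathcal H$-rough path: (a) $T_v$ maps characters to characters, (b) $T_v$ is a morphism for $*$, (c) $\sup_{s\ne t}|\langle T_v(\mathbb X_{st}),x\rangle|/|t-s|^{\gamma|x|}<\infty$ for $x\in\mathcal B$; 4. there is a coaction (linear map; no coassociativity is required) $\rho_T:\mathcal H\to S(\mathcal H_{in}\times\mathcal B_1)\otimes\mathcal H$ with $\langle T_v(\chi),x\rangle=\langle e^v\otimes\chi,\rho_T(x)\rangle$ for all $\chi\in\overline{\mathcal H^*}$, $x\in\mathcal H$ and all $v$. **Substitution.** A family of algebra morphisms $S_v:\overline{\mathcal H^*}\to\overline{\mathcal H^*}$, indexed by the same tuples, is a substitution if: (1) $S_v(e_i)=v_i$ for all $e_i\in\mathcal B_1$; (2) $S_v\circ S_u=S_{S_v(u)}$,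 where $S_v(u)=\{S_v(u_1),\dots,S_v(u_n)\}$; and conditions 3 and 4 of the definition of translation hold with $T_v,\rho_T$ replaced by $S_v,\rho_S$. *)

(* Defs.v *)
From HB Require Import structures.
From mathcomp Require Import all_boot all_order all_algebra.
From mathcomp Require Import generic_quotient ring_quotient sesquilinear.
From mathcomp Require Import all_classical reals prodnormedzmodule exp.

Set Implicit Arguments.
Unset Strict Implicit.
Unset Printing Implicit Defensive.

Import Order.TTheory GRing.Theory Num.Theory.

Local Open Scope ring_scope.
Local Open Scope quotient_scope.

Notation isbilinear f := (bilinear_for *:%R *:%R f).

Section LmodQuotient.
Context (R : pzRingType) (V : lmodType R) (W : submodClosed V).

Let Wzmod : zmodClosed V := HB.pack (GRing.SubmodClosed.sort W)
  (GRing.isZmodClosed.Build V _ (GRing.submod_closedB (submodClosedP W))).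

Definition lquot : Type := Quotient.quot Wzmod.
HB.instance Definition _ := GRing.Zmodule.on lquot.

Definition lcls (x : V) : lquot := \pi x.
Definition lrep (w : lquot) : V := repr w.

Lemma lclsP x y : reflect (lcls x = lcls y) (x - y \in W).
Proof.
have -> : (x - y \in W) = (x - y \in Wzmod) by [].
by rewrite Quotient.idealrBE; exact: eqP.
Qed.

Lemma lrepK : cancel lrep lcls. Proof. exact: reprK. Qed.

Lemma lrep_cls x : lrep (lcls x) - x \in W.
Proof. by apply/lclsP; rewrite lrepK. Qed.

Lemma lclsD x y : lcls (x + y) = lcls x + lcls y.
Proof. by rewrite /lcls piE. Qed.

Definition lscale (a : R) (w : lquot) : lquot := lcls (a *: lrep w).

Lemma lclsZ a x : lcls (a *: x) = lscale a (lcls x).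
Proof.
by apply/lclsP; rewrite -scalerBr rpredZ //; apply/lclsP; rewrite lrepK.
Qed.

Fact lscaleA a b w : lscale a (lscale b w) = lscale (a * b) w.
Proof. by rewrite -lclsZ scalerA. Qed.
Fact lscale1 : left_id 1 lscale.
Proof. by move=> w; rewrite /lscale scale1r lrepK. Qed.
Fact lscaleDr : right_distributive lscale +%R.
Proof.
by move=> a v w; rewrite -{1}[v]lrepK -{1}[w]lrepK -lclsD -lclsZ scalerDr lclsD.
Qed.
Fact lscaleDl w : {morph lscale^~ w : a b / a + b}.
Proof.
by move=> a b; rewrite /lscale scalerDl lclsD.
Qed.

HB.instance Definition _ :=
  GRing.Zmodule_isLmodule.Build R lquot lscaleA lscale1 lscaleDr lscaleDl.

Fact lcls_is_linear : linear lcls.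
Proof. by move=> a x y; rewrite lclsD lclsZ. Qed.
HB.instance Definition _ :=
  GRing.isLinear.Build R V lquot *:%R lcls lcls_is_linear.

End LmodQuotient.

Section Tensor.
Context (R : comNzRingType) (U V : lmodType R).

Definition tens_ev (W : lmodType R) (f : U -> V -> W) (s : seq (U * V)) : W :=
  \sum_(p <- s) f p.1 p.2.

Definition tens_equiv (s t : seq (U * V)) : bool :=
  `[< forall (W : lmodType R) (f : U -> V -> W), isbilinear f ->
        tens_ev f s = tens_ev f t >].

Fact tens_equiv_class : equiv_class_of tens_equiv.
Proof.
split=> [s|s t|t s r].
- by apply/asboolP.
- by apply/asboolP/asboolP => H W f fB; rewrite H.
- by move=> /asboolP H1 /asboolP H2; apply/asboolP => W f fB; rewrite H1 ?H2.
Qed.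

Canonical tens_equiv_equiv := EquivRelPack tens_equiv_class.
Canonical tens_equiv_enc := defaultEncModRel tens_equiv.

(* U (x) V: formal sums of pure tensors, two sums being identified when every
   bilinear map takes the same value on them, i.e. the universal property. *)
Definition tensor : Type := {eq_quot tens_equiv}.
HB.instance Definition _ := Choice.on tensor.

Let cls (s : seq (U * V)) : tensor := \pi_({eq_quot tens_equiv}) s.
Let rep (z : tensor) : seq (U * V) := repr (z : {eq_quot tens_equiv}).

Definition tens_lift (W : lmodType R) (f : U -> V -> W) of isbilinear f :=
  fun z : tensor => tens_ev f (rep z).

Let repE (W : lmodType R) (f : U -> V -> W) s : isbilinear f ->
  tens_ev f (rep (cls s)) = tens_ev f s.
Proof.
move=> fB; have /eqmodP/asboolP : rep (cls s) = s %[mod {eq_quot tens_equiv}].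
  exact: reprK.
by apply.
Qed.

Let tensP (x y : tensor) :
  (forall (W : lmodType R) (f : U -> V -> W), isbilinear f ->
     tens_ev f (rep x) = tens_ev f (rep y)) -> x = y.
Proof.
move=> H; suff : cls (rep x) = cls (rep y) by rewrite /cls /rep !reprK.
by apply/eqmodP/asboolP.
Qed.

Let scale_s (a : R) (s : seq (U * V)) := [seq (a *: p.1, p.2) | p <- s].

Let ev_scale (W : lmodType R) (f : U -> V -> W) a s : isbilinear f ->
  tens_ev f (scale_s a s) = a *: tens_ev f s.
Proof.
move=> fB; rewrite /tens_ev big_map scaler_sumr; apply: eq_bigr => p _ /=.
by have := scalable_linear (fB.1 p.2) a p.1.
Qed.

Let ev_cat (W : lmodType R) (f : U -> V -> W) s t :
  tens_ev f (s ++ t) = tens_ev f s + tens_ev f t.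
Proof. by rewrite /tens_ev big_cat. Qed.

Let zero : tensor := cls [::].
Let add (x y : tensor) : tensor := cls (rep x ++ rep y).
Let scale (a : R) (x : tensor) : tensor := cls (scale_s a (rep x)).
Let opp (x : tensor) : tensor := scale (-1) x.

Let ev0 (W : lmodType R) (f : U -> V -> W) : isbilinear f -> tens_ev f (rep zero) = 0.
Proof. by move=> fB; rewrite repE // /tens_ev big_nil. Qed.
Let evD (W : lmodType R) (f : U -> V -> W) x y : isbilinear f ->
  tens_ev f (rep (add x y)) = tens_ev f (rep x) + tens_ev f (rep y).
Proof. by move=> fB; rewrite repE // ev_cat. Qed.
Let evZ (W : lmodType R) (f : U -> V -> W) a x : isbilinear f ->
  tens_ev f (rep (scale a x)) = a *: tens_ev f (rep x).
Proof. by move=> fB; rewrite repE // ev_scale. Qed.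

Fact tens_addA : associative add.
Proof. by move=> x y z; apply: tensP => W f fB; rewrite !evD // addrA. Qed.
Fact tens_addC : commutative add.
Proof. by move=> x y; apply: tensP => W f fB; rewrite !evD // addrC. Qed.
Fact tens_add0 : left_id zero add.
Proof. by move=> x; apply: tensP => W f fB; rewrite evD // ev0 // add0r. Qed.
Fact tens_addN : left_inverse zero opp add.
Proof.
by move=> x; apply: tensP => W f fB; rewrite evD // evZ // ev0 // scaleN1r addNr.
Qed.
HB.instance Definition _ := GRing.isZmodule.Build tensor
  tens_addA tens_addC tens_add0 tens_addN.

Fact tens_scaleA a b x : scale a (scale b x) = scale (a * b) x.
Proof. by apply: tensP => W f fB; rewrite !evZ // scalerA. Qed.
Fact tens_scale1 : left_id 1 scale.
Proof. by move=> x; apply: tensP => W f fB; rewrite !evZ // scale1r. Qed.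
Fact tens_scaleDr : right_distributive scale +%R.
Proof.
move=> a x y; apply: tensP => W f fB.
by rewrite !(evD, evZ) // scalerDr.
Qed.
Fact tens_scaleDl x : {morph scale^~ x : a b / a + b}.
Proof.
move=> a b; apply: tensP => W f fB.
by rewrite !(evD, evZ) // scalerDl.
Qed.
HB.instance Definition _ := GRing.Zmodule_isLmodule.Build R tensor
  tens_scaleA tens_scale1 tens_scaleDr tens_scaleDl.

Fact tens_lift_is_linear (W : lmodType R) (f : U -> V -> W) (fB : isbilinear f) :
  linear (tens_lift fB).
Proof. by move=> a x y; rewrite /tens_lift evD // evZ. Qed.
HB.instance Definition _ (W : lmodType R) (f : U -> V -> W) (fB : isbilinear f) :=
  GRing.isLinear.Build R tensor W *:%R (tens_lift fB) (tens_lift_is_linear fB).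

Definition tens (u : U) (v : V) : tensor := cls [:: (u, v)].

Lemma tens_liftE (W : lmodType R) (f : U -> V -> W) (fB : isbilinear f) u v :
  tens_lift fB (tens u v) = f u v.
Proof. by rewrite /tens_lift repE // /tens_ev big_seq1. Qed.

Lemma tens_bilinear : isbilinear tens.
Proof.
split=> [v a x y|u a x y]; apply: tensP => W f fB;
  rewrite evD // evZ // !repE // /tens_ev !big_seq1 /=.
- exact: fB.1.
- exact: fB.2.
Qed.

Lemma tens_span (z : tensor) :
  exists s : seq (U * V), z = \sum_(p <- s) tens p.1 p.2.
Proof.
exists (rep z); apply: tensP => W f fB.
rewrite -[LHS]/(tens_lift fB z) -[RHS]/(tens_lift fB _) linear_sum /=.
by apply: eq_bigr => p _; rewrite tens_liftE.
Qed.

Lemma tens_lift_uniq (W : lmodType R) (g h : {linear tensor -> W}) :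
  (forall u v, g (tens u v) = h (tens u v)) -> g =1 h.
Proof.
move=> gh z; have [s ->] := tens_span z; rewrite !linear_sum.
by apply: eq_bigr.
Qed.

End Tensor.

Arguments tensor {R} U V.

Section TensorMaps.
Context (R : comNzRingType).

Fact tens_map_bilinear (U V U' V' : lmodType R)
    (f : {linear U -> U'}) (g : {linear V -> V'}) :
  isbilinear (fun u v => tens (f u) (g v)).
Proof.
have [tl tr] := tens_bilinear U' V'.
by split=> [v a x y|u a x y] /=; rewrite linearP; [exact: tl|exact: tr].
Qed.

Definition tens_map (U V U' V' : lmodType R)
    (f : {linear U -> U'}) (g : {linear V -> V'}) :
    {linear tensor U V -> tensor U' V'} :=
  tens_lift (tens_map_bilinear f g).

Fact tens_assoc_bilinear1 (U V W : lmodType R) (u : U) :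
  isbilinear (fun v w => tens (tens u v) w : tensor (tensor U V) W).
Proof.
have [tl tr] := tens_bilinear U V; have [tl' tr'] := tens_bilinear (tensor U V) W.
split=> [w a x y|v a x y] /=; last exact: tr'.
by rewrite (tr u) (tl' w).
Qed.

Fact tens_assoc_bilinear (U V W : lmodType R) :
  isbilinear (fun u => tens_lift (@tens_assoc_bilinear1 U V W u)).
Proof.
have [tl tr] := tens_bilinear U V; have [tl' tr'] := tens_bilinear (tensor U V) W.
split=> [z a x y|u a x y]; last by rewrite linearP.
have [s zE] := tens_span z.
have E t : tens_lift (@tens_assoc_bilinear1 U V W t) z =
    \sum_(p <- s) tens (tens t p.1) p.2.
  by rewrite zE linear_sum; apply: eq_bigr => p _; rewrite /= tens_liftE.
rewrite /= !E scaler_sumr -big_split /=.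
by apply: eq_bigr => p _; rewrite (tl p.1) (tl' p.2).
Qed.

Definition tens_assoc (U V W : lmodType R) :
    {linear tensor U (tensor V W) -> tensor (tensor U V) W} :=
  tens_lift (tens_assoc_bilinear U V W).

Fact scale_bilinear (U V : lmodType R) (f : {linear U -> R^o}) :
  isbilinear (fun u (v : V) => f u *: v).
Proof.
split=> [v a x y|u a x y] /=; first by rewrite linearP scalerDl scalerA.
by rewrite scalerDr !scalerA mulrC.
Qed.

Fact scale_bilinearr (U V : lmodType R) (f : {linear V -> R^o}) :
  isbilinear (fun (u : U) v => f v *: u).
Proof.
split=> [v a x y|u a x y] /=; last by rewrite linearP scalerDl scalerA.
by rewrite scalerDr !scalerA mulrC.
Qed.

Fact dpair_bilinear (U V : lmodType R)
    (f : {linear U -> R^o}) (g : {linear V -> R^o}) :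
  isbilinear (fun u v => (f u * g v : R^o)).
Proof.
split=> [v a x y|u a x y] /=; rewrite linearP.
  by rewrite mulrDl -scalerAl.
by rewrite mulrDr -scalerAr.
Qed.

(* the form f (x) g on U (x) V *)
Definition dpair (U V : lmodType R)
    (f : {linear U -> R^o}) (g : {linear V -> R^o}) :
    {linear tensor U V -> R^o} :=
  tens_lift (dpair_bilinear f g).

Fact mul_bilinear (A : algType R) (f g : {linear A -> A}) :
  isbilinear (fun x y => f x * g y).
Proof.
split=> [v a x y|u a x y] /=; rewrite linearP.
  by rewrite mulrDl scalerAl.
by rewrite mulrDr scalerAr.
Qed.

Fact tens_mul_bilinear1 (A B : algType R) (a : A) (b : B) :
  isbilinear (fun c d => tens (a * c) (b * d)).
Proof.
have [tl tr] := tens_bilinear A B.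
by split=> [d k x y|c k x y] /=; rewrite mulrDr -scalerAr; [exact: tl|exact: tr].
Qed.

Fact tens_mul_bilinear2 (A B : algType R) (z : tensor A B) :
  isbilinear (fun a b => tens_lift (tens_mul_bilinear1 a b) z).
Proof.
have [tl tr] := tens_bilinear A B; have [s zE] := tens_span z.
have E a b : tens_lift (tens_mul_bilinear1 a b) z =
    \sum_(p <- s) tens (a * p.1) (b * p.2).
  by rewrite zE linear_sum; apply: eq_bigr => p _; rewrite /= tens_liftE.
split=> [b k x y|a k x y]; rewrite /= !E scaler_sumr -big_split /=;
  apply: eq_bigr => p _; rewrite mulrDl -scalerAl; [exact: tl|exact: tr].
Qed.

(* the product of the algebra A (x) B: (a (x) b)(c (x) d) = ac (x) bd *)
Definition tens_mul (A B : algType R) (y z : tensor A B) : tensor A B :=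
  tens_lift (tens_mul_bilinear2 z) y.

Lemma tens_mulE (A B : algType R) (a c : A) (b d : B) :
  tens_mul (tens a b) (tens c d) = tens (a * c) (b * d).
Proof. by rewrite /tens_mul !tens_liftE. Qed.

End TensorMaps.

Section SymAlg.
Context (R : comNzRingType) (V : lmodType R).

Let T := seq (R * seq V).

Definition sym_ev (A : comAlgType R) (f : V -> A) (p : T) : A :=
  \sum_(m <- p) m.1 *: \prod_(v <- m.2) f v.

Definition sym_equiv (p q : T) : bool :=
  `[< forall (A : comAlgType R) (f : V -> A), linear f ->
        sym_ev f p = sym_ev f q >].

Fact sym_equiv_class : equiv_class_of sym_equiv.
Proof.
split=> [s|s t|t s r].
- by apply/asboolP.
- by apply/asboolP/asboolP => H A f fL; rewrite H.
- by move=> /asboolP H1 /asboolP H2; apply/asboolP => A f fL; rewrite H1 ?H2.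
Qed.

Canonical sym_equiv_equiv := EquivRelPack sym_equiv_class.
Canonical sym_equiv_enc := defaultEncModRel sym_equiv.

(* S(V): formal linear combinations of words in V, two combinations being
   identified when every linear map from V to a commutative algebra evaluates
   them to the same element, i.e. the universal property. *)
Definition symalg : Type := {eq_quot sym_equiv}.
HB.instance Definition _ := Choice.on symalg.

Let cls (p : T) : symalg := \pi_({eq_quot sym_equiv}) p.
Let rep (z : symalg) : T := repr (z : {eq_quot sym_equiv}).

Definition sym_lift (A : comAlgType R) (f : {linear V -> A}) :=
  fun z : symalg => sym_ev f (rep z).

Let repE (A : comAlgType R) (f : V -> A) p : linear f ->
  sym_ev f (rep (cls p)) = sym_ev f p.
Proof.
move=> fL; have /eqmodP/asboolP : rep (cls p) = p %[mod {eq_quot sym_equiv}].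
  exact: reprK.
by apply.
Qed.

Let symP (x y : symalg) :
  (forall (A : comAlgType R) (f : V -> A), linear f ->
     sym_ev f (rep x) = sym_ev f (rep y)) -> x = y.
Proof.
move=> H; suff : cls (rep x) = cls (rep y) by rewrite /cls /rep !reprK.
by apply/eqmodP/asboolP.
Qed.

Let zero : symalg := cls [::].
Let one : symalg := cls [:: (1, [::])].
Let add (x y : symalg) : symalg := cls (rep x ++ rep y).
Let scale (a : R) (x : symalg) : symalg :=
  cls [seq (a * m.1, m.2) | m <- rep x].
Let opp (x : symalg) : symalg := scale (-1) x.
Let mul (x y : symalg) : symalg :=
  cls [seq (m.1 * m'.1, m.2 ++ m'.2) | m <- rep x, m' <- rep y].

Let ev0 (A : comAlgType R) (f : V -> A) : linear f -> sym_ev f (rep zero) = 0.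
Proof. by move=> fL; rewrite repE // /sym_ev big_nil. Qed.
Let ev1 (A : comAlgType R) (f : V -> A) : linear f -> sym_ev f (rep one) = 1.
Proof. by move=> fL; rewrite repE // /sym_ev big_seq1 big_nil scale1r. Qed.
Let evD (A : comAlgType R) (f : V -> A) x y : linear f ->
  sym_ev f (rep (add x y)) = sym_ev f (rep x) + sym_ev f (rep y).
Proof. by move=> fL; rewrite repE // /sym_ev big_cat. Qed.
Let evZ (A : comAlgType R) (f : V -> A) a x : linear f ->
  sym_ev f (rep (scale a x)) = a *: sym_ev f (rep x).
Proof.
move=> fL; rewrite repE // /sym_ev big_map scaler_sumr.
by apply: eq_bigr => m _; rewrite scalerA.
Qed.
Let evM (A : comAlgType R) (f : V -> A) x y : linear f ->
  sym_ev f (rep (mul x y)) = sym_ev f (rep x) * sym_ev f (rep y).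
Proof.
move=> fL; rewrite repE // /sym_ev big_allpairs_dep /= mulr_suml.
apply: eq_bigr => m _; rewrite mulr_sumr; apply: eq_bigr => m' _.
by rewrite big_cat /= -scalerAl -scalerAr scalerA.
Qed.

Fact sym_addA : associative add.
Proof. by move=> x y z; apply: symP => A f fL; rewrite !evD // addrA. Qed.
Fact sym_addC : commutative add.
Proof. by move=> x y; apply: symP => A f fL; rewrite !evD // addrC. Qed.
Fact sym_add0 : left_id zero add.
Proof. by move=> x; apply: symP => A f fL; rewrite evD // ev0 // add0r. Qed.
Fact sym_addN : left_inverse zero opp add.
Proof.
by move=> x; apply: symP => A f fL; rewrite evD // evZ // ev0 // scaleN1r addNr.
Qed.
HB.instance Definition _ := GRing.isZmodule.Build symalg
  sym_addA sym_addC sym_add0 sym_addN.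

Fact sym_mulA : associative mul.
Proof. by move=> x y z; apply: symP => A f fL; rewrite !evM // mulrA. Qed.
Fact sym_mulC : commutative mul.
Proof. by move=> x y; apply: symP => A f fL; rewrite !evM // mulrC. Qed.
Fact sym_mul1 : left_id one mul.
Proof. by move=> x; apply: symP => A f fL; rewrite evM // ev1 // mul1r. Qed.
Fact sym_mulDl : left_distributive mul +%R.
Proof.
by move=> x y z; apply: symP => A f fL; rewrite !(evM, evD) // mulrDl.
Qed.
Fact sym_one_neq0 : one != 0.
Proof.
apply/eqP => /(congr1 (fun z => sym_ev (\0 : V -> R^o) (rep z))).
have L : linear (\0 : V -> R^o) by move=> a x y; rewrite /= scaler0 addr0.
by rewrite ev1 // ev0 //; apply/eqP; exact: oner_neq0.
Qed.
HB.instance Definition _ := GRing.Zmodule_isComNzRing.Build symalg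
  sym_mulA sym_mulC sym_mul1 sym_mulDl sym_one_neq0.

Fact sym_scaleA a b x : scale a (scale b x) = scale (a * b) x.
Proof. by apply: symP => A f fL; rewrite !evZ // scalerA. Qed.
Fact sym_scale1 : left_id 1 scale.
Proof. by move=> x; apply: symP => A f fL; rewrite !evZ // scale1r. Qed.
Fact sym_scaleDr : right_distributive scale +%R.
Proof.
by move=> a x y; apply: symP => A f fL; rewrite !(evD, evZ) // scalerDr.
Qed.
Fact sym_scaleDl x : {morph scale^~ x : a b / a + b}.
Proof.
by move=> a b; apply: symP => A f fL; rewrite !(evD, evZ) // scalerDl.
Qed.
HB.instance Definition _ := GRing.Zmodule_isLmodule.Build R symalg
  sym_scaleA sym_scale1 sym_scaleDr sym_scaleDl.

Fact sym_scaleAl (a : R) (x y : symalg) : a *: (x * y) = (a *: x) * y.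
Proof.
by apply: symP => A f fL; rewrite !(evM, evZ) // scalerAl.
Qed.
HB.instance Definition _ := GRing.Lmodule_isLalgebra.Build R symalg sym_scaleAl.
HB.instance Definition _ := GRing.Lalgebra_isComAlgebra.Build R symalg.

Definition sym_gen (v : V) : symalg := cls [:: (1, [:: v])].

Fact sym_gen_is_linear : linear sym_gen.
Proof.
move=> a x y; apply: symP => A f fL.
by rewrite evD // evZ // !repE // /sym_ev !big_seq1 !scale1r; exact: fL.
Qed.
HB.instance Definition _ :=
  GRing.isLinear.Build R V symalg *:%R sym_gen sym_gen_is_linear.

Section Lift.
Context (A : comAlgType R) (f : {linear V -> A}).

Fact sym_lift_is_linear : linear (sym_lift f).
Proof.
move=> a x y; rewrite /sym_lift evD ?evZ //; exact: linearP.
Qed.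
HB.instance Definition _ :=
  GRing.isLinear.Build R symalg A *:%R (sym_lift f) sym_lift_is_linear.

Fact sym_lift_is_monoid : monoid_morphism (sym_lift f).
Proof.
split=> [|x y]; first by apply: ev1; exact: linearP.
by apply: evM; exact: linearP.
Qed.
HB.instance Definition _ :=
  GRing.isMonoidMorphism.Build symalg A (sym_lift f) sym_lift_is_monoid.

Lemma sym_liftE v : sym_lift f (sym_gen v) = f v.
Proof.
by rewrite /sym_lift repE ?/sym_ev ?big_seq1 ?scale1r //; exact: linearP.
Qed.

End Lift.

Lemma sym_span (z : symalg) : exists p : seq (R * seq V),
  z = \sum_(m <- p) m.1 *: \prod_(v <- m.2) sym_gen v.
Proof.
exists (rep z); apply: symP => A f fL.
pose fl : {linear V -> A} := HB.pack f (GRing.isLinear.Build R V A *:%R f fL).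
rewrite -[LHS]/(sym_lift fl z) -[RHS]/(sym_lift fl _) linear_sum /=.
apply: eq_bigr => m _; rewrite linearZ rmorph_prod /=; congr (_ *: _).
by apply: eq_bigr => v _; rewrite sym_liftE.
Qed.

Lemma sym_lift_uniq (A : comAlgType R) (g h : {lrmorphism symalg -> A}) :
  (forall v, g (sym_gen v) = h (sym_gen v)) -> g =1 h.
Proof.
move=> gh z; have [p ->] := sym_span z; rewrite !linear_sum.
apply: eq_bigr => m _; rewrite !linearZ /= !rmorph_prod; congr (_ *: _).
by apply: eq_bigr => v _; exact: gh.
Qed.

End SymAlg.

Section Dual.
Context (R : comNzRingType) (V : lmodType R).

Definition dual : Type := {linear V -> R^o}.
HB.instance Definition _ := Choice.on dual.

Lemma dual_ext (f g : dual) : f =1 g -> f = g.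
Proof.
case: f g => [f cf] [g cg] /= /funext fg; move: cf cg; rewrite fg => cf cg.
by congr GRing.Linear.Pack; case: cf cg => [[a] [b]] [[c] [d]];
  congr GRing.Linear.Class; congr (_ _); exact: Prop_irrelevance.
Qed.

Let zero : dual := \0.
Let add (f g : dual) : dual := f \+ g.
Let opp (f : dual) : dual := \- f.
Let scale (a : R) (f : dual) : dual := a \*: f.

Fact dual_addA : associative add.
Proof. by move=> f g h; apply: dual_ext => x /=; rewrite addrA. Qed.
Fact dual_addC : commutative add.
Proof. by move=> f g; apply: dual_ext => x /=; rewrite addrC. Qed.
Fact dual_add0 : left_id zero add.
Proof. by move=> f; apply: dual_ext => x /=; rewrite add0r. Qed.
Fact dual_addN : left_inverse zero opp add.
Proof. by move=> f; apply: dual_ext => x /=; rewrite addNr. Qed.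
HB.instance Definition _ := GRing.isZmodule.Build dual
  dual_addA dual_addC dual_add0 dual_addN.

Fact dual_scaleA a b f : scale a (scale b f) = scale (a * b) f.
Proof. by apply: dual_ext => x /=; rewrite scalerA. Qed.
Fact dual_scale1 : left_id 1 scale.
Proof. by move=> f; apply: dual_ext => x /=; rewrite scale1r. Qed.
Fact dual_scaleDr : right_distributive scale +%R.
Proof. by move=> a f g; apply: dual_ext => x /=; rewrite scalerDr. Qed.
Fact dual_scaleDl f : {morph scale^~ f : a b / a + b}.
Proof. by move=> a b; apply: dual_ext => x /=; rewrite scalerDl. Qed.
HB.instance Definition _ := GRing.Zmodule_isLmodule.Build R dual
  dual_scaleA dual_scale1 dual_scaleDr dual_scaleDl.

Lemma dualDE (f g : dual) x : (f + g) x = f x + g x. Proof. by []. Qed.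
Lemma dualNE (f : dual) x : (- f) x = - f x. Proof. by []. Qed.
Lemma dualZE a (f : dual) x : (a *: f) x = a * f x. Proof. by []. Qed.
Lemma dual0E x : (0 : dual) x = 0. Proof. by []. Qed.

End Dual.

(* A basis together with its family of coordinate forms (the dual basis). *)
Record lmod_basis (R : comNzRingType) (I : choiceType) (V : lmodType R) :=
  LmodBasis {
    bvec :> I -> V;
    bcoord : I -> dual V;
    bcoordE : forall i j, bcoord i (bvec j) = (i == j)%:R;
    bspan : forall x, exists s : seq I,
      uniq s /\ x = \sum_(i <- s) bcoord i x *: bvec i
  }.

(* Indices of a basis of a graded space with [d n] elements in degree [n]. *)
Definition bidx (d : nat -> nat) : choiceType := {n : nat & 'I_(d n)}.

Section Graded.
Context (R : comNzRingType) (V : lmodType R) (d : nat -> nat)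
  (B : lmod_basis (bidx d) V).

(* V_n, the span of the basis elements of degree n *)
Definition homog (n : nat) (x : V) : Prop :=
  forall i : bidx d, tag i != n -> bcoord B i x = 0.

Definition tens_homog (n : nat) (z : tensor V V) : Prop :=
  exists s : seq (V * V),
    (forall p, p \in s ->
       exists i j, [/\ (i + j)%N = n, homog i p.1 & homog j p.2]) /\
    z = \sum_(p <- s) tens p.1 p.2.

End Graded.

Record is_bialgebra (R : comNzRingType) (H : algType R)
    (Delta : {linear H -> tensor H H}) (eps : {linear H -> R^o}) : Prop := {
  bialg_coassoc : forall x,
    tens_assoc H H H (tens_map idfun Delta (Delta x)) =
    tens_map Delta idfun (Delta x);
  bialg_counitl : forall x, tens_lift (scale_bilinear H eps) (Delta x) = x;
  bialg_counitr : forall x, tens_lift (scale_bilinearr H eps) (Delta x) = x;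
  bialg_Delta1 : Delta 1 = tens 1 1;
  bialg_DeltaM : forall x y, Delta (x * y) = tens_mul (Delta x) (Delta y);
  bialg_eps1 : eps 1 = 1;
  bialg_epsM : forall x y, eps (x * y) = eps x * eps y
}.

Definition is_antipode (R : comNzRingType) (H : algType R)
    (Delta : {linear H -> tensor H H}) (eps : {linear H -> R^o})
    (S : {linear H -> H}) : Prop := forall x,
  tens_lift (mul_bilinear S idfun) (Delta x) = eps x *: 1 /\
  tens_lift (mul_bilinear idfun S) (Delta x) = eps x *: 1.

Record combHopf (R : realType) := CombHopf {
  hopf_alg :> algType R;
  Delta : {linear hopf_alg -> tensor hopf_alg hopf_alg};
  counit : {linear hopf_alg -> R^o};
  antipode : {linear hopf_alg -> hopf_alg};
  hopf_bialg : is_bialgebra Delta counit;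
  hopf_antipode : is_antipode Delta counit antipode;
  hdim : nat -> nat;
  hbasis : lmod_basis (bidx hdim) hopf_alg;
  hopf_graded1 : homog hbasis 0 1;
  hopf_gradedM : forall m n x y, homog hbasis m x -> homog hbasis n y ->
    homog hbasis (m + n) (x * y);
  hopf_graded_Delta : forall n x, homog hbasis n x ->
    tens_homog hbasis n (Delta x);
  hopf_graded_counit : forall n x, homog hbasis n x -> (0 < n)%N ->
    counit x = 0;
  hopf_connected : forall x, homog hbasis 0 x -> exists k : R, x = k *: 1;
  hopf_growth : exists b c : R, [/\ 0 < b, 0 < c &
    forall n, (hdim n)%:R <= b * c ^+ n];
  hopf_mul_nat : forall i j k,
    (bcoord hbasis k (hbasis i * hbasis j) : R) \is a Num.nat;
  hopf_Delta_nat : forall i j k,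
    (dpair (bcoord hbasis j) (bcoord hbasis k) (Delta (hbasis i)) : R)
      \is a Num.nat
}.

Section CombHopfTheory.
Context (R : realType) (H : combHopf R).

Definition deg (i : bidx (hdim H)) : nat := tag i.

Definition hprimitive (x : H) : Prop := Delta H x = tens x 1 + tens 1 x.

Definition hnondegenerate : Prop :=
  forall i : bidx (hdim H), hprimitive (hbasis H i) <-> deg i = 1%N.

(* e_i is indexed by i : 'I_nB1. *)
Definition nB1 : nat := hdim H 1.

Definition idx1 (i : 'I_nB1) : bidx (hdim H) := existT _ 1%N i.
Definition evec (i : 'I_nB1) : H := hbasis H (idx1 i).
Definition edual (i : 'I_nB1) : dual H := bcoord (hbasis H) (idx1 i).

Definition conv (f g : dual H) : dual H := dpair f g \o Delta H.

Definition hcharacter (f : dual H) : Prop :=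
  f 1 = 1 /\ forall x y, f (x * y) = f x * f y.

Definition dprim_pred : {pred dual H} := fun f =>
  `[< f 1 = 0 /\
      forall x y, counit H x = 0 -> counit H y = 0 -> f (x * y) = 0 >].

Fact dprim_submod : submod_closed dprim_pred.
Proof.
split=> [|a f g /asboolP[f1 fM] /asboolP[g1 gM]]; apply/asboolP; split=> //.
  by rewrite dualDE dualZE f1 g1 mulr0 addr0.
by move=> x y x0 y0; rewrite dualDE dualZE fM // gM // mulr0 addr0.
Qed.
HB.instance Definition _ :=
  GRing.isSubmodClosed.Build R (dual H) dprim_pred dprim_submod.

(* the primitive elements (infinitesimal characters) of the completed dual *)
Record dprim := DPrim { dprim_val : dual H; _ : dprim_val \in dprim_pred }.
HB.instance Definition _ := [isSub for dprim_val].
HB.instance Definition _ := [Choice of dprim by <:].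
HB.instance Definition _ := [SubChoice_isSubLmodule of dprim by <:].

Definition aug_pred : {pred H} := fun x => counit H x == 0.

Fact aug_submod : submod_closed aug_pred.
Proof.
split=> [|a x y /eqP x0 /eqP y0]; apply/eqP; first by rewrite linear0.
by rewrite linearP x0 y0 scaler0 addr0.
Qed.
HB.instance Definition _ :=
  GRing.isSubmodClosed.Build R H aug_pred aug_submod.

Lemma dprimP (v : dprim) : dprim_val v 1 = 0 /\
  forall x y, counit H x = 0 -> counit H y = 0 -> dprim_val v (x * y) = 0.
Proof. by case: v => v /= /asboolP. Qed.

(* the augmentation ideal, kernel of the counit *)
Record aug := Aug { aug_val : H; _ : aug_val \in aug_pred }.
HB.instance Definition _ := [isSub for aug_val].
HB.instance Definition _ := [Choice of aug by <:].
HB.instance Definition _ := [SubChoice_isSubLmodule of aug by <:].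

Lemma augP (x : aug) : counit H (aug_val x) = 0.
Proof. by case: x => x /= /eqP. Qed.

Definition decomp_pred : {pred aug} := fun x =>
  `[< exists s : seq (aug * aug),
        aug_val x = \sum_(p <- s) aug_val p.1 * aug_val p.2 >].

Fact decomp_submod : submod_closed decomp_pred.
Proof.
split=> [|a x y /asboolP[s xE] /asboolP[t yE]]; apply/asboolP.
  by exists [::]; rewrite big_nil.
exists ([seq (a *: p.1, p.2) | p <- s] ++ t).
rewrite big_cat big_map /= -yE; congr (_ + _).
rewrite -[LHS]/(a *: aug_val x) xE scaler_sumr; apply: eq_bigr => p _ /=.
by rewrite scalerAl.
Qed.
HB.instance Definition _ :=
  GRing.isSubmodClosed.Build R aug decomp_pred decomp_submod.

Definition Hin : lmodType R := lquot decomp_pred.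
Definition incls : aug -> Hin := @lcls R aug decomp_pred.

(* S(H_in x B_1); an element of H_in x B_1 is the family of its components
   along the e_i. *)
Definition HinB1 : lmodType R := {ffun 'I_nB1 -> Hin}.
Definition SH : comAlgType R := symalg HinB1.

Definition pairB1 (w : Hin) (i : 'I_nB1) : HinB1 :=
  [ffun j => if j == i then w else 0].
Definition gen (w : Hin) (i : 'I_nB1) : SH := sym_gen (pairB1 w i).

Definition prim_in (v : dprim) (w : Hin) : R^o := dprim_val v (aug_val (lrep w)).

Lemma prim_inE (v : dprim) (x : aug) : prim_in v (incls x) = dprim_val v (aug_val x).
Proof.
apply/eqP; rewrite -subr_eq0 /prim_in -linearB.
have /asboolP[s E] := lrep_cls (decomp_pred : submodClosed aug) x.
rewrite -[X in dprim_val v X]/(aug_val (lrep (incls x) - x)) E linear_sum /=.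
have [_ vM] := dprimP v.
by rewrite big1 // => p _; apply: vM; apply: augP.
Qed.

Fact prim_in_is_linear v : linear (prim_in v).
Proof.
move=> a w1 w2.
have -> : a *: w1 + w2 = incls (a *: lrep w1 + lrep w2).
  by rewrite /incls linearP; congr (_ *: _ + _); exact/esym/lrepK.
by rewrite prim_inE /= linearP.
Qed.
HB.instance Definition _ v :=
  GRing.isLinear.Build R Hin R^o *:%R (prim_in v) (prim_in_is_linear v).

Definition ptuple : Type := {ffun 'I_nB1 -> dprim}.
HB.instance Definition _ := GRing.Lmodule.on ptuple.

Definition ev_form (v : ptuple) (f : HinB1) : R^o := \sum_i prim_in (v i) (f i).

Fact ev_form_is_linear v : linear (ev_form v).
Proof.
move=> a f g; rewrite /ev_form scaler_sumr -big_split /=.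
by apply: eq_bigr => i _; rewrite !ffunE linearP.
Qed.
HB.instance Definition _ v :=
  GRing.isLinear.Build R HinB1 R^o *:%R (ev_form v) (ev_form_is_linear v).

(* the character e^v of S(H_in x B_1) *)
Definition expchar (v : ptuple) : {lrmorphism SH -> R^o} :=
  sym_lift (ev_form v).

Lemma expcharE v w i : expchar v (gen w i) = prim_in (v i) w.
Proof.
rewrite /expchar /= sym_liftE /= /ev_form (bigD1 i) //= ffunE eqxx.
rewrite big1 ?addr0 // => j /negPf ji; by rewrite ffunE ji linear0.
Qed.

Lemma homog_pos (x : aug) i : deg i = 0%N -> bcoord (hbasis H) i (aug_val x) = 0.
Proof.
move=> i0; have [s [_ xE]] := bspan (hbasis H) (aug_val x).
set c := fun j => bcoord (hbasis H) j (aug_val x).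
pose x0 : H := \sum_(j <- s | deg j == 0%N) c j *: hbasis H j.
pose x1 : H := \sum_(j <- s | deg j != 0%N) c j *: hbasis H j.
have x01 : aug_val x = x0 + x1 by rewrite xE (bigID (fun j => deg j == 0%N)).
have x0h : homog (hbasis H) 0 x0.
  move=> j j0; rewrite linear_sum big1 // => k /eqP k0.
  rewrite linearZ /= bcoordE; case: eqP => [jk|_]; last exact: mulr0.
  by move: j0; rewrite jk -/(deg k) k0.
have [k x0E] := hopf_connected x0h.
have e1 : counit H x1 = 0.
  rewrite linear_sum big1 // => j j0; rewrite linearZ /=.
  rewrite (@hopf_graded_counit _ H (deg j) (hbasis H j)) ?lt0n //.
    exact: mulr0.
  by move=> l lj; rewrite bcoordE; case: eqP => // E; rewrite E eqxx in lj.
have k0 : k = 0.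
  have := augP x; rewrite x01 linearD e1 addr0 x0E linearZ /=.
  by rewrite (bialg_eps1 (hopf_bialg H)) => <-; rewrite [RHS]mulr1.
rewrite x01 x0E k0 scale0r add0r linear_sum big1 // => j j0.
rewrite linearZ /= bcoordE; case: eqP => [ij|_]; last exact: mulr0.
by rewrite -ij i0 in j0.
Qed.

Fact evec_aug i : evec i \in aug_pred.
Proof.
apply/eqP; apply: (@hopf_graded_counit _ H 1) => // j j1.
rewrite bcoordE; case: eqP => // E; by rewrite E eqxx in j1.
Qed.
Definition eaug (i : 'I_nB1) : aug := Aug (evec_aug i).

Fact edual_prim i : edual i \in dprim_pred.
Proof.
apply/asboolP; split; first exact: (@hopf_graded1 _ H (idx1 i)).
move=> x y /eqP x0 /eqP y0; rewrite /edual.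
have [s [_ xE]] := bspan (hbasis H) x; have [t [_ yE]] := bspan (hbasis H) y.
rewrite xE yE mulr_suml linear_sum big1 // => j _.
rewrite mulr_sumr linear_sum big1 // => k _.
rewrite -scalerAl -scalerAr !linearZ /=.
have [j0|j0] := eqVneq (deg j) 0%N.
  by rewrite (@homog_pos (Aug x0) j j0) scale0r.
have [k0|k0] := eqVneq (deg k) 0%N.
  by rewrite (@homog_pos (Aug y0) k k0) scale0r scaler0.
have hb l : homog (hbasis H) (deg l) (hbasis H l).
  by move=> m ml; rewrite bcoordE; case: eqP => // E; rewrite E eqxx in ml.
rewrite (hopf_gradedM (hb j) (hb k)) ?scaler0 //=.
by move: j0 k0; case: (deg j) => // m; case: (deg k) => // p; rewrite addSn addnS.
Qed.
Definition eprim (i : 'I_nB1) : dprim := DPrim (edual_prim i).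
Definition etuple : ptuple := [ffun i => eprim i].

Definition rough_path (gamma : R) (X : R -> R -> dual H) : Prop :=
  [/\ forall s t, hcharacter (X s t),
      forall s u t, conv (X s u) (X u t) = X s t
    & forall i : bidx (hdim H), exists C : R, forall s t, s != t ->
        `|X s t (hbasis H i) : R| / `|t - s| `^ (gamma * (deg i)%:R) <= C].

(* morphisms of the algebra (dual H, conv), whose unit is the counit *)
Definition conv_morphism (F : dual H -> dual H) : Prop :=
  [/\ linear F, F (counit H) = counit H
    & forall f g, F (conv f g) = conv (F f) (F g)].

Definition dfamily := ptuple -> dual H -> dual H.

Definition preserves_rough_paths (gamma : R) (T : dfamily) : Prop :=
  forall v,
  [/\ forall f, hcharacter f -> hcharacter (T v f),
      forall f g, T v (conv f g) = conv (T v f) (T v g)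
    & forall X, rough_path gamma X -> rough_path gamma (fun s t => T v (X s t))].

Definition is_coaction (T : dfamily) (rho : {linear H -> tensor SH H}) : Prop :=
  forall (v : ptuple) (f : dual H) (x : H),
    T v f x = dpair (expchar v) f (rho x).

(* In [trans_comp], w is the index v + T_v(u), whose entries must be primitive
   for T_w to make sense; likewise w is S_v(u) in [subst_comp]. *)
Record translation (gamma : R) (T : dfamily) : Prop := {
  trans_morphism : forall v, conv_morphism (T v);
  trans_edual : forall v i, T v (edual i) = edual i + dprim_val (v i);
  trans_comp : forall v u : ptuple, exists w : ptuple,
    (forall i, dprim_val (w i) = dprim_val (v i) + T v (dprim_val (u i))) /\
    forall f, T v (T u f) = T w f;
  trans_rough : preserves_rough_paths gamma T;
  trans_coaction : exists rho, is_coaction T rho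
}.

Record substitution (gamma : R) (S : dfamily) : Prop := {
  subst_morphism : forall v, conv_morphism (S v);
  subst_edual : forall v i, S v (edual i) = dprim_val (v i);
  subst_comp : forall v u : ptuple, exists w : ptuple,
    (forall i, dprim_val (w i) = S v (dprim_val (u i))) /\
    forall f, S v (S u f) = S w f;
  subst_rough : preserves_rough_paths gamma S;
  subst_coaction : exists rho, is_coaction S rho
}.

(* a basis of H_in made of classes of homogeneous elements and containing the
   classes of the e_i *)
Definition homog_basis_containing_B1 (J : choiceType) (w : lmod_basis J Hin) :
    Prop :=
  (forall j, exists n (x : aug), homog (hbasis H) n (aug_val x) /\ w j = incls x) /\
  (forall i, exists j, w j = incls (eaug i)).

End CombHopfTheory.

Arguments eaug {R H} i.
Arguments etuple {R} H.

(* Main.v *)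
(** By the two coaction identities and T_(v-e) = S_v, the form e^u (x) f sends
    rhoT(x) to T_u(f)(x) = S_(u+e)(f)(x), the value of e^(u+e) (x) f at rhoS(x).
    On generators one checks e^u o phi = e^(u+e), so rhoT(x) and
    (phi (x) Id)(rhoS(x)) have the same image under every e^u (x) f. It remains
    to see that these forms separate the points of S(H_in x B_1) (x) H: every
    linear form on H_in comes from an infinitesimal character, so the e^u are all
    the characters of the symmetric algebra, and a polynomial vanishing at every
    point over an infinite field is zero. *)
Require Import Defs.
From HB Require Import structures.
From mathcomp Require Import all_boot all_order all_algebra.
From mathcomp Require Import all_classical reals.

Set Implicit Arguments.
Unset Strict Implicit.
Unset Printing Implicit Defensive.

Import Order.TTheory GRing.Theory Num.Theory.
Local Open Scope ring_scope.

(** * Coordinates in a basis and separation of tensors *)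

Lemma tens_lift_sum (R : comNzRingType) (U V W : lmodType R) (f : U -> V -> W)
    (fB : isbilinear f) (s : seq (U * V)) :
  tens_lift fB (\sum_(p <- s) tens p.1 p.2) = \sum_(p <- s) f p.1 p.2.
Proof. by rewrite linear_sum; apply: eq_bigr => p _; rewrite /= tens_liftE. Qed.

Section Basis.
Context (R : comNzRingType) (I : choiceType) (V : lmodType R).
Variable B : lmod_basis I V.

Lemma bcoord_sum (l : seq I) (c : I -> R) k : uniq l ->
  bcoord B k (\sum_(i <- l) c i *: B i) = if k \in l then c k else 0.
Proof.
move=> lU; rewrite linear_sum /=.
have E i : bcoord B k (c i *: B i) = if i == k then c i else 0.
  rewrite linearZ /= bcoordE eq_sym; case: eqP => _; first exact: mulr1.
  exact: mulr0.
under eq_bigr => i _ do rewrite E.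
case: ifP => kl.
  by rewrite (bigD1_seq k) //= eqxx big1 ?addr0 // => i /negPf->.
by rewrite big1_seq // => i /= il; case: eqP => // ik; rewrite -ik il in kl.
Qed.

Lemma bcoord_inj (x y : V) : (forall k, bcoord B k x = bcoord B k y) -> x = y.
Proof.
move=> xy; apply/eqP; rewrite -subr_eq0; apply/eqP.
have [s [_ ->]] := bspan B (x - y); rewrite big1 // => i _.
by rewrite linearB /= xy subrr scale0r.
Qed.

(** One list [l] serves all of [xs], so that a finite sum of tensors can be expanded over the same
    basis vectors and its sums exchanged. *)
Lemma bspan_seq (xs : seq V) : exists l : seq I, uniq l /\
  {in xs, forall x, x = \sum_(i <- l) bcoord B i x *: B i}.
Proof.
elim: xs => [|x xs [l [lU lE]]]; first by exists [::].
have [s [sU sE]] := bspan B x; exists (undup (s ++ l)).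
split=> [|y]; first exact: undup_uniq.
(* Indices outside an expansion carry zero coordinates, so the list of an expansion can be enlarged
   freely. *)
have ext t : uniq t -> {subset t <= undup (s ++ l)} ->
    y = \sum_(i <- t) bcoord B i y *: B i ->
    y = \sum_(i <- undup (s ++ l)) bcoord B i y *: B i.
  move=> tU tsub yE; apply: bcoord_inj => k.
  rewrite bcoord_sum ?undup_uniq //; case: ifPn => // kN.
  rewrite yE bcoord_sum // ifF //; apply/negbTE; apply: contra kN; exact: tsub.
rewrite inE => /predU1P[yx|yxs].
  apply: (ext s) => // [i|]; last by rewrite yx.
  by rewrite mem_undup mem_cat => ->.
apply: (ext l) => // [i|]; last exact: lE.
by rewrite mem_undup mem_cat orbC => ->.
Qed.

Lemma linear_basis_ext (W : lmodType R) (f g : {linear V -> W}) :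
  (forall i, f (B i) = g (B i)) -> f =1 g.
Proof.
move=> fg x; have [s [_ ->]] := bspan B x; rewrite !linear_sum.
by apply: eq_bigr => i _; rewrite !linearZ /= fg.
Qed.

(** Expanding the second factors over a common finite list gives $z=\sum_k z_k\otimes B_k$, where
    $z_k$ is the contraction of $z$ with the $k$-th coordinate form. *)
Lemma tensor_coord_eq0 (U : lmodType R) (z : tensor U V) :
  (forall k, tens_lift (scale_bilinearr U (bcoord B k)) z = 0) -> z = 0.
Proof.
move=> z0; have [s zE] := tens_span z.
have [l [_ lE]] := bspan_seq [seq p.2 | p <- s].
have [tl tr] := tens_bilinear U V.
pose tL v : {linear U -> tensor U V} := HB.pack (fun u : U => tens u v)
  (GRing.isLinear.Build R U (tensor U V) *:%R (fun u : U => tens u v) (tl v)).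
pose tR u : {linear V -> tensor U V} := HB.pack (fun v : V => tens u v)
  (GRing.isLinear.Build R V (tensor U V) *:%R (fun v : V => tens u v) (tr u)).
have -> : z = \sum_(k <- l)
    tL (B k) (tens_lift (scale_bilinearr U (bcoord B k)) z).
  under eq_bigr => k _ do rewrite {1}zE tens_lift_sum linear_sum.
  rewrite exchange_big {1}zE big_seq [RHS]big_seq; apply: eq_bigr => p ps.
  rewrite -[LHS]/(tR p.1 p.2) {1}(lE p.2) ?map_f // linear_sum.
  apply: eq_bigr => k _; rewrite !linearZ.
  by [].
by rewrite big1 // => k _; rewrite z0 linear0.
Qed.

(** The coordinate forms deal with the factor [V], so only [U] needs a separating family; it may be
    smaller than the full dual, as with the characters $e^u$ below. *)
Lemma dpair_separates (U : lmodType R) (F : dual U -> Prop)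
    (F_sep : forall u, (forall f, F f -> f u = 0) -> u = 0) (z : tensor U V) :
  (forall f g, F f -> dpair f g z = 0) -> z = 0.
Proof.
move=> z0; apply: tensor_coord_eq0 => k; apply: F_sep => f Ff.
rewrite -(z0 f (bcoord B k) Ff); have [s ->] := tens_span z.
rewrite /dpair /= !tens_lift_sum linear_sum; apply: eq_bigr => p _.
by rewrite linearZ mulrC.
Qed.

End Basis.

(** The numbers $0,\dots,\mathrm{size}(p)-1$ are distinct in characteristic zero: as roots of a
    nonzero [p] they would be one more than its degree allows. *)
Lemma poly_eq0_nat (K : numFieldType) (p : {poly K}) :
  (forall n : nat, p.[n%:R] = 0) -> p = 0.
Proof.
move=> p0; apply/eqP; apply: contraT => pN0.
have := @max_poly_roots _ p [seq n%:R | n <- iota 0 (size p)] pN0.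
rewrite size_map size_iota ltnn; apply.
  by apply/allP => _ /mapP[n _ ->]; rewrite /root p0.
by rewrite map_inj_uniq ?iota_uniq // => m n /eqP; rewrite eqr_nat => /eqP.
Qed.

(** * Characters separate the points of a symmetric algebra *)

Section SymSeparation.
Context (K : numFieldType) (I : choiceType) (V : lmodType K).
Variable B : lmod_basis I V.

(* The subalgebra generated by the basis vectors listed in [l], presented as an
   iterated polynomial ring so that induction on [l] removes one variable. *)
Fixpoint symsub (l : seq I) (z : symalg V) : Prop :=
  if l is i :: l' then
    exists p : {poly symalg V},
      (forall k, symsub l' p`_k) /\ z = p.[sym_gen (B i)]
  else exists a : K, z = a%:A.

Lemma symsub_scalar l a : symsub l a%:A.
Proof.
elim: l a => [|i l IH] a /=; first by exists a.
exists (a%:A)%:P; rewrite hornerC; split=> // k.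
by rewrite coefC; case: ifP => // _; rewrite -[0](scale0r 1).
Qed.

Lemma symsub0 l : symsub l 0.
Proof. by rewrite -[0](scale0r 1); apply: symsub_scalar. Qed.

Lemma symsub1 l : symsub l 1.
Proof. by rewrite -[1]scale1r; apply: symsub_scalar. Qed.

Lemma symsubD l x y : symsub l x -> symsub l y -> symsub l (x + y).
Proof.
elim: l x y => [|i l IH] x y /=.
  by move=> [a ->] [b ->]; exists (a + b); rewrite scalerDl.
move=> [p [pl ->]] [q [ql ->]]; exists (p + q); rewrite hornerD; split=> // k.
by rewrite coefD; apply: IH.
Qed.

Lemma symsubM l x y : symsub l x -> symsub l y -> symsub l (x * y).
Proof.
elim: l x y => [|i l IH] x y /=.
  by move=> [a ->] [b ->]; exists (a * b); rewrite -scalerAl mul1r scalerA.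
move=> [p [pl ->]] [q [ql ->]]; exists (p * q); rewrite hornerM; split=> // k.
rewrite coefM; apply: (big_ind (symsub l)); first exact: symsub0.
  exact: symsubD.
by move=> j _; apply: IH.
Qed.

Lemma symsubZ l a x : symsub l x -> symsub l (a *: x).
Proof.
by move=> xl; rewrite -[x]mul1r scalerAl; apply: symsubM => //; apply: symsub_scalar.
Qed.

Lemma symsub_gen l i : i \in l -> symsub l (sym_gen (B i)).
Proof.
elim: l => //= j l IH; rewrite inE => /predU1P[->|/IH il].
  exists 'X; rewrite hornerX; split=> // k; rewrite coefX.
  by case: eqP => _; [exact: symsub1 | exact: symsub0].
exists (sym_gen (B i))%:P; rewrite hornerC; split=> // k; rewrite coefC.
by case: ifP => // _; exact: symsub0.
Qed.

(** Finitely many words make up [z], and their letters involve finitely many basis vectors. *)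
Lemma symsub_exists z : exists l, uniq l /\ symsub l z.
Proof.
have [p ->] := sym_span z.
have [l [lU lE]] := bspan_seq B (flatten [seq m.2 | m <- p]).
exists l; split=> //; rewrite big_seq.
apply: (big_ind (symsub l)) => [||m mp]; [exact: symsub0 | exact: symsubD |].
apply: symsubZ; rewrite big_seq.
apply: (big_ind (symsub l)) => [||v vm]; [exact: symsub1 | exact: symsubM |].
rewrite (lE v); last by apply/flattenP; exists m.2 => //; apply: map_f.
rewrite linear_sum big_seq.
apply: (big_ind (symsub l)) => [||i il]; [exact: symsub0 | exact: symsubD |].
by rewrite linearZ; apply/symsubZ/symsub_gen.
Qed.

Lemma sym_lift_symsub (f g : dual V) l z : {in l, forall i, f (B i) = g (B i)} ->
  symsub l z -> sym_lift f z = sym_lift g z.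
Proof.
elim: l z => [|i l IH] z fg /=; first by move=> [a ->]; rewrite !linearZ !rmorph1.
move=> [p [pl ->]]; rewrite -!horner_map /= !sym_liftE fg ?mem_head //.
congr (_.[_]); apply/polyP => k; rewrite !coef_map /=.
by apply: IH => // j jl; apply: fg; rewrite inE jl orbT.
Qed.

(** Induction on the number of variables. Applying the character of [f] to the coefficients of [p]
    leaves a polynomial over [K] that vanishes at every natural number, so each coefficient of [p]
    is killed by every character and the induction hypothesis applies to it. *)
Lemma symsub_eq0 l z : uniq l -> symsub l z ->
  (forall f : dual V, sym_lift f z = 0) -> z = 0.
Proof.
elim: l z => [|i l IH] z /=.
  move=> _ [a ->] z0; have := z0 0; rewrite linearZ rmorph1 /=.
  by move=> a0; rewrite -[a]mulr1 [a * 1]a0 scale0r.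
move=> /andP[il lU] [p [pl ->]] z0.
suff -> : p = 0 by rewrite horner0.
apply/polyP => k; rewrite coef0; apply: IH => // f.
(* f is shifted along the dual vector of [B i] to sweep all values at [B i]
   without changing the coefficients of p. *)
pose g (n : nat) : dual V := f + (n%:R - f (B i)) *: bcoord B i.
have gi n : g n (B i) = n%:R :> K.
  by rewrite dualDE dualZE bcoordE eqxx mulr1 addrC subrK.
pose sf : {lrmorphism symalg V -> K^o} := sym_lift f.
suff : map_poly sf p = 0.
  by move=> /polyP/(_ k); rewrite coef_map /= coef0.
apply: poly_eq0_nat => n; rewrite -[RHS](z0 (g n)) -horner_map /= sym_liftE gi.
congr (_.[_]); apply/polyP => m.
pose sg : {lrmorphism symalg V -> K^o} := sym_lift (g n).
rewrite (coef_map sf) [RHS](coef_map sg) /=.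
apply: (sym_lift_symsub _ (pl m)) => j jl.
rewrite dualDE dualZE bcoordE; case: eqP => [ij|_]; first by rewrite ij jl in il.
by rewrite mulr0 addr0.
Qed.

Lemma sym_lift_separates (z : symalg V) :
  (forall f : dual V, sym_lift f z = 0) -> z = 0.
Proof. by have [l [lU zl]] := symsub_exists z; apply: symsub_eq0 lU zl. Qed.

End SymSeparation.

Section CombHopf.
Context (R : realType) (H : combHopf R).

(** * The basis of pairs $(b_j,e_i)$ of [HinB1] *)

Section HinB1Basis.
Context (J : choiceType) (b : lmod_basis J (Hin H)).

Let fvec (q : J * 'I_(nB1 H)) : HinB1 H := pairB1 (b q.1) q.2.

Let fform (q : J * 'I_(nB1 H)) (f : HinB1 H) : R^o := bcoord b q.1 (f q.2).

Fact fform_linear q : linear (fform q).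
Proof. by move=> a f g; rewrite /fform !ffunE linearP. Qed.
HB.instance Definition _ q :=
  GRing.isLinear.Build R (HinB1 H) R^o *:%R (fform q) (fform_linear q).

Let fcoord q : dual (HinB1 H) := fform q.

Fact fcoordE p q : fcoord p (fvec q) = (p == q)%:R.
Proof.
rewrite /= /fform ffunE -pair_eqE /pair_eq /=.
by case: eqP => _; rewrite ?linear0 ?bcoordE ?andbT ?andbF.
Qed.

Fact fspan f : exists s : seq (J * 'I_(nB1 H)),
  uniq s /\ f = \sum_(q <- s) fcoord q f *: fvec q.
Proof.
have [l [lU lE]] := bspan_seq b (codom f).
exists [seq (j, i) | j <- l, i <- enum 'I_(nB1 H)].
split; first by apply: allpairs_uniq; rewrite ?enum_uniq // => -[? ?] [? ?].
rewrite big_allpairs_dep /=; apply/ffunP => i; rewrite sum_ffunE.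
rewrite [LHS]lE ?codom_f //; apply: eq_bigr => j _.
rewrite sum_ffunE big_enum /= (bigD1 i) //= !ffunE eqxx big1 ?addr0 //.
by move=> k ki; rewrite !ffunE eq_sym (negPf ki) scaler0.
Qed.

Definition HinB1_basis : lmod_basis (J * 'I_(nB1 H))%type (HinB1 H) :=
  LmodBasis fcoordE fspan.

End HinB1Basis.

(** * Infinitesimal characters and characters $e^v$ from linear forms *)

Section PrimOfForm.
Variable f : dual (Hin H).

Fact sub_counit_aug (x : H) : x - counit H x *: 1 \in aug_pred (H := H).
Proof.
apply/eqP; rewrite linearB linearZ /= (bialg_eps1 (hopf_bialg H)).
by rewrite [_ *: 1]mulr1 subrr.
Qed.

(** The projection onto $\ker\epsilon$ along the line of the unit. *)
Definition aug_proj (x : H) : aug H := Aug (sub_counit_aug x).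

Definition form_of_Hin (x : H) : R^o := f (incls (aug_proj x)).

Fact form_of_Hin_linear : linear form_of_Hin.
Proof.
move=> a x y; rewrite /form_of_Hin -linearP /= /incls -linearP /=.
congr (f (lcls _ _)); apply: val_inj => /=.
rewrite linearP /= scalerDl opprD addrACA scalerBr scalerA.
by [].
Qed.
HB.instance Definition _ :=
  GRing.isLinear.Build R H R^o *:%R form_of_Hin form_of_Hin_linear.

Lemma form_of_Hin_aug (x : aug H) : form_of_Hin (aug_val x) = f (incls x).
Proof.
congr (f (incls _)); apply: val_inj => /=.
by rewrite augP scale0r subr0.
Qed.

(** The projection kills the unit, and a product of two elements of $\ker\epsilon$ has zero class in
    [Hin]. *)
Fact form_of_Hin_prim : (form_of_Hin : dual H) \in dprim_pred (H := H).
Proof.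
apply/asboolP; split=> [|x y x0 y0].
  rewrite /= /form_of_Hin; have -> : aug_proj 1 = 0.
    apply: val_inj => /=.
    by rewrite (bialg_eps1 (hopf_bialg H)) scale1r subrr.
  by rewrite /incls !linear0.
pose x' : aug H := Aug (introT eqP x0 : x \in aug_pred (H := H)).
pose y' : aug H := Aug (introT eqP y0 : y \in aug_pred (H := H)).
rewrite /= /form_of_Hin; suff -> : incls (aug_proj (x * y)) = 0 by rewrite linear0.
rewrite /incls -(linear0 (lcls (decomp_pred (H := H)))); apply/lclsP.
rewrite subr0; apply/asboolP; exists [:: (x', y')].
by rewrite big_seq1 /= (bialg_epsM (hopf_bialg H)) x0 y0 mulr0 scale0r subr0.
Qed.

Definition prim_of_form : dprim H := DPrim form_of_Hin_prim.

Lemma prim_of_formE w : prim_in prim_of_form w = f w.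
Proof.
by rewrite -[w]lrepK -/(incls _) prim_inE [LHS]form_of_Hin_aug.
Qed.

End PrimOfForm.

(** [pairB1] with its arguments swapped, so that fixing [i] leaves a linear map in [w]. *)
Definition pairB1r (i : 'I_(nB1 H)) (w : Hin H) : HinB1 H := pairB1 w i.

Fact pairB1r_linear i : linear (pairB1r i).
Proof.
move=> a v w; apply/ffunP => k; rewrite !ffunE.
by case: eqP => // _; rewrite scaler0 addr0.
Qed.
HB.instance Definition _ i := GRing.isLinear.Build R (Hin H) (HinB1 H) *:%R
  (pairB1r i) (pairB1r_linear i).

Definition tuple_of_form (f : dual (HinB1 H)) : ptuple H :=
  [ffun i => prim_of_form (f \o pairB1r i : dual (Hin H))].

Lemma ev_form_tuple (f : dual (HinB1 H)) : ev_form (tuple_of_form f) =1 f.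
Proof.
move=> g; rewrite /ev_form.
under eq_bigr => i _ do rewrite ffunE prim_of_formE /=.
rewrite -linear_sum; congr (f _); apply/ffunP => i.
rewrite sum_ffunE (bigD1 i) //= ffunE eqxx big1 ?addr0 // => k ki.
by rewrite ffunE eq_sym (negPf ki).
Qed.

(** By [ev_form_tuple] every linear form on [HinB1] is some [ev_form v], so the $e^v$ exhaust the
    characters given by [sym_lift]. *)
Lemma expchar_separates (J : choiceType) (b : lmod_basis J (Hin H)) (s : SH H) :
  (forall u, expchar u s = 0) -> s = 0.
Proof.
move=> s0; apply: (sym_lift_separates (HinB1_basis b)) => f.
rewrite -(s0 (tuple_of_form f)).
apply: (sym_lift_uniq (g := sym_lift f : {lrmorphism SH H -> R^o})).
by move=> g; rewrite /expchar /= !sym_liftE; exact/esym/ev_form_tuple.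
Qed.

(** * The degree-one part and its dual basis *)

Lemma idx1_eq (i k : 'I_(nB1 H)) : (idx1 i == idx1 k) = (i == k).
Proof. exact: (@eq_Tagged _ _ (idx1 i) k). Qed.

Lemma edual_evec (i k : 'I_(nB1 H)) : edual i (evec k) = (i == k)%:R.
Proof. by rewrite /edual /evec bcoordE idx1_eq. Qed.

Lemma homog1_sum (x : H) : homog (hbasis H) 1 x ->
  x = \sum_k edual k x *: evec k.
Proof.
move=> x1; apply: (bcoord_inj (B := hbasis H)) => -[m l].
rewrite linear_sum /=; have [m1|m1] := eqVneq m 1%N; last first.
  rewrite x1 // big1 // => k _; rewrite linearZ /= bcoordE.
  by case: eqP => [[E]|_]; [rewrite E eqxx in m1 | exact: mulr0].
subst m; rewrite -/(idx1 l) (bigD1 l) //= big1 ?addr0 => [|k kl].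
  by rewrite linearZ /= bcoordE eqxx [RHS]mulr1.
by rewrite linearZ /= bcoordE idx1_eq eq_sym (negPf kl); exact: mulr0.
Qed.

Lemma eprim_eaug (i k : 'I_(nB1 H)) :
  prim_in (eprim i) (incls (eaug k)) = (i == k)%:R.
Proof. by rewrite prim_inE [LHS]edual_evec. Qed.

(** The form [edual i] vanishes on representatives of degree other than 1. A representative [x] of
    degree 1 is a combination of the $e_k$, whose classes also belong to [b]; hence the coordinate
    of [b j] along the class of $e_i$ is [edual i x], and it is zero when [b j] is another basis
    vector. *)
Lemma eprim_basis (J : choiceType) (b : lmod_basis J (Hin H)) :
  homog_basis_containing_B1 b ->
  forall i j, prim_in (eprim i) (b j) = (b j == incls (eaug i))%:R.
Proof.
move=> [bh b1] i j; case: eqP => [->|bji]; first by rewrite eprim_eaug eqxx.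
have [n [x [xh bjx]]] := bh j; rewrite bjx prim_inE /=.
have [n1|n1] := eqVneq n 1%N; last by apply: xh; rewrite eq_sym.
subst n; have xE : x = \sum_k edual k (aug_val x) *: eaug k.
  apply: val_inj; rewrite raddf_sum /= {1}(homog1_sum xh).
  by [].
have [ji bji1] := b1 i.
have : bcoord b ji (b j) = 0.
  by rewrite bcoordE; case: eqP => // E; case: bji; rewrite -bji1 E.
have cE k a : bcoord b ji (lcls _ (a *: eaug k)) = a * bcoord b ji (incls (eaug k)).
  by rewrite !linearZ.
rewrite bjx {1}xE /incls linear_sum /= linear_sum (bigD1 i) //= big1 ?addr0.
  by rewrite cE -bji1 bcoordE eqxx mulr1.
move=> k ki; rewrite cE; have [jk bjk] := b1 k.
rewrite -bjk bcoordE; case: eqP => [E|_]; last exact: mulr0.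
(* Distinct $e_k$ and $e_i$ have distinct classes: [eprim i] takes the values 0 and 1 on them. *)
have := eprim_eaug i k; rewrite -bjk -E bji1 eprim_eaug eqxx eq_sym (negPf ki).
by move/eqP; rewrite oner_eq0.
Qed.

(** Two algebra morphisms are compared on the generators $(b_j,e_i)$. Adding [etuple] to [u] adds
    [eprim i] of $b_j$, which is 1 at the class of $e_i$ and 0 elsewhere: exactly the constant
    inserted by [phi]. *)
Lemma expchar_shift (J : choiceType) (b : lmod_basis J (Hin H))
    (b_homog : homog_basis_containing_B1 b) (phi : {lrmorphism SH H -> SH H})
    (phi_gen : forall (j : J) (i : 'I_(nB1 H)),
       phi (gen (b j) i) =
         if b j == incls (eaug i) then 1 + gen (incls (eaug i)) i
         else gen (b j) i) (u : ptuple H) :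
  expchar u \o phi =1 expchar (u + etuple H).
Proof.
apply: sym_lift_uniq.
apply: (linear_basis_ext (B := HinB1_basis b)
  (f := expchar u \o phi \o @sym_gen R (HinB1 H))
  (g := expchar (u + etuple H) \o @sym_gen R (HinB1 H))) => -[j i] /=.
rewrite -/(gen _ _) phi_gen !expcharE.
have -> : prim_in ((u + etuple H) i) (b j) =
    prim_in (u i) (b j) + prim_in (eprim i) (b j) by rewrite !ffunE.
rewrite (eprim_basis b_homog); case: eqP => [->|_].
  by rewrite rmorphD rmorph1 /= expcharE addrC.
by rewrite expcharE addr0.
Qed.

Lemma dpair_tens_map (U V W : lmodType R) (h : {linear U -> V}) (f : dual V)
    (g : dual W) z : dpair f g (tens_map h idfun z) = dpair (f \o h : dual U) g z.
Proof.
have [s ->] := tens_span z; rewrite /dpair /= !tens_lift_sum linear_sum.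
by apply: eq_bigr => p _; rewrite /= tens_liftE.
Qed.

End CombHopf.

Theorem proposition4p3 (R : realType) (H : combHopf R)
    (H_comm : forall x y : H, x * y = y * x)
    (H_nondeg : hnondegenerate H)
    (gamma : R) (gamma_itv : 0 < gamma <= 1)
    (S T : dfamily H)
    (rhoS rhoT : {linear H -> tensor (SH H) H})
    (S_subst : substitution gamma S) (rhoS_coact : is_coaction S rhoS)
    (T_trans : translation gamma T) (rhoT_coact : is_coaction T rhoT)
    (T_induced : forall v : ptuple H, T (v - etuple H) = S v)
    (J : choiceType) (b : lmod_basis J (Hin H))
    (b_homog : homog_basis_containing_B1 b)
    (phi : {lrmorphism SH H -> SH H})
    (phi_gen : forall (j : J) (i : 'I_(nB1 H)),
       phi (gen (b j) i) =
         if b j == incls (eaug i) then 1 + gen (incls (eaug i)) i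
         else gen (b j) i) :
  rhoT =1 tens_map phi idfun \o rhoS.
Proof.
move=> x; apply/eqP; rewrite -subr_eq0; apply/eqP.
pose F (f : dual (SH H)) := exists u, f = expchar u.
apply: (dpair_separates (hbasis H) (F := F)) => [s s0|_ g [u ->]].
  by apply: (expchar_separates b) => u; apply: s0; exists u.
apply/eqP; rewrite linearB subr_eq0; apply/eqP => /=.
rewrite -rhoT_coact dpair_tens_map.
(* [T_induced] is taken at [u + etuple H], so it reaches every index [u] of [T]. *)
have -> : T u = S (u + etuple H) by rewrite -T_induced addrK.
rewrite rhoS_coact; congr (dpair _ _ _); apply: dual_ext => s.
exact/esym/(expchar_shift b_homog phi_gen).
Qed.
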